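(* Let $\Lambda_2=(\lambda_1,\lambda_2)\in(\mathbb C^* )^2$ and $\kappa\in\mathbb C$. Then $\Omega'(\Lambda_2,\kappa)$ is the unique irreducible $\bar S_2$-submodule of $\Omega(\Lambda_2,\kappa)$, and the quotient $\Omega(\Lambda_2,\kappa)/\Omega'(\Lambda_2,\kappa)\cong\mathbb C$ is one-dimensional.
   Context: All vector spaces and algebras are over $\mathbb C$; $\mathbb C^*=\mathbb C\setminus\{0\}$. Let $\mathcal A_2=\mathbb C[t_1^{\pm1},t_2^{\pm1}]$, $\partial_i=t_i\frac{\partial}{\partial t_i}$, $t^r=t_1^{r_1}t_2^{r_2}$ for $r=(r_1,r_2)\in\mathbb Z^2$. The Witt algebra is $\mathcal W_2=\mathcal A_2\partial_1\oplus\mathcal A_2\partial_2$ with bracket $[t^r\partial_i,t^s\partial_j]=s_it^{r+s}\partial_j-r_jt^{r+s}\partial_i$. The Lie algebra $\bar S_2$ is its subalgebra $$\bar S_2=\mathrm{Span}_{\mathbb C}\{\partial_1,\partial_2,\ (r_2+1)t^r\partial_1-(r_1+1)t^r\partial_2 : r\in\mathbb Z^2,\ r\ne(-2,-2)\}.$$ The $\bar S_2$-module $\Omega(\Lambda_2,\kappa)$ is the vector space $\mathbb C[h_1,h_2]$ on which $\partial_i$ acts as multiplication by $h_i$ ($i=1,2$) and, for $r\neq(-2,-2)$, $$\bigl((r_2+1)t^r\partial_1-(r_1+1)t^r\partial_2\bigr)\cdot f(h_1,h_2)=\lambda_1^{r_1}\lambda_2^{r_2}\bigl((r_2+1)h_1-(r_1+1)h_2+(r_1-r_2)\kappa\bigr)f(h_1-r_1,h_2-r_2).$$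 $\Omega'(\Lambda_2,\kappa)=\langle h_1-\kappa,h_2-\kappa\rangle$ is the ideal of the polynomial algebra $\mathbb C[h_1,h_2]$ generated by $h_1-\kappa$ and $h_2-\kappa$; it is an $\bar S_2$-submodule. *)

(* Defs.v *)
From HB Require Import structures.
From mathcomp Require Import all_boot all_order all_algebra generic_quotient ring_quotient.
From mathcomp Require Import finmap monalg mpoly ring.
From mathcomp Require Import boolp.

Set Implicit Arguments.
Unset Strict Implicit.
Unset Printing Implicit Defensive.

Import GRing.Theory Num.Theory.
Local Open Scope ring_scope.
Local Open Scope quotient_scope.

HB.mixin Record Lmodule_isLieAlgebra (K : fieldType) L of GRing.Lmodule K L := {
  lie : L -> L -> L;
  lie_linearl : forall y, linear (lie^~ y);
  lie_linearr : forall x, linear (lie x);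
  liexx : forall x, lie x x = 0;
  lie_jacobi : forall x y z,
    lie x (lie y z) + lie y (lie z x) + lie z (lie x y) = 0
}.

#[short(type="lieAlgType")]
HB.structure Definition LieAlgebra (K : fieldType) :=
  {L of GRing.Lmodule K L & Lmodule_isLieAlgebra K L}.

Section Modules.
Variables (K : fieldType) (L : lieAlgType K).

Record lie_module := LieModule {
  lm_sort :> lmodType K;
  lm_act : L -> lm_sort -> lm_sort;
  lm_linearl : forall v, linear (lm_act^~ v);
  lm_linearr : forall x, linear (lm_act x);
  lm_lie : forall x y v,
    lm_act (lie x y) v = lm_act x (lm_act y v) - lm_act y (lm_act x v)
}.

(* Subsets are bool-valued predicates; under the classical axioms of [boolp]
   these are arbitrary subsets. *)
Record submodule (M : lie_module) := Submodule {
  sm_pred :> {pred M};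
  sm_closed : submod_closed sm_pred;
  sm_act : forall x v, v \in sm_pred -> lm_act x v \in sm_pred
}.

Definition irreducible (M : lie_module) (W : submodule M) : Prop :=
  (exists2 v, v \in W & v != 0) /\
  forall N : submodule M, {subset N <= W} ->
    (forall v, v \in N -> v = 0) \/ N =i W.

Section Quotient.
Variables (M : lie_module) (W : submodule M).

Definition sm_mem : M -> bool := fun v => v \in W.
Fact sm_mem_closed : submod_closed sm_mem.
Proof. exact: sm_closed. Qed.
HB.instance Definition _ := GRing.isSubmodClosed.Build K M sm_mem sm_mem_closed.

Definition sm_zmodClosed : zmodClosed M := GRing.ZmodClosed.clone M sm_mem _.

Definition quot_sort := Quotient.quot sm_zmodClosed.
HB.instance Definition _ := EqQuotient.on quot_sort.
HB.instance Definition _ := GRing.Zmodule.on quot_sort.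

Definition quot_pi (v : M) : quot_sort := \pi v.
Definition quot_scale (a : K) (q : quot_sort) : quot_sort :=
  quot_pi (a *: repr q).
Definition quot_act (x : L) (q : quot_sort) : quot_sort :=
  quot_pi (lm_act x (repr q)).

Lemma quot_piP u v : reflect (quot_pi u = quot_pi v) (u - v \in W).
Proof.
rewrite -[_ \in W]/(u - v \in sm_zmodClosed) Quotient.idealrBE.
exact: eqP.
Qed.

Lemma quot_reprK q : quot_pi (repr q) = q.
Proof. exact: reprK. Qed.

Lemma quot_piD u v : quot_pi (u + v) = quot_pi u + quot_pi v.
Proof. by rewrite /quot_pi !piE. Qed.

Lemma quot_piN u : quot_pi (- u) = - quot_pi u.
Proof. by rewrite /quot_pi !piE. Qed.

Lemma quot_piZ a v : quot_pi (a *: v) = quot_scale a (quot_pi v).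
Proof.
apply/quot_piP; rewrite -scalerBr -[_ *: _]addr0.
have [W0 Wlin] := sm_closed W; apply: Wlin => //.
by apply/quot_piP; rewrite quot_reprK.
Qed.

Lemma quot_piact x v : quot_pi (lm_act x v) = quot_act x (quot_pi v).
Proof.
apply/quot_piP; pose w := repr (quot_pi v).
have -> : lm_act x v - lm_act x w = lm_act x (v - w).
  have := lm_linearr x (-1) w v.
  by rewrite !scaleN1r => E; rewrite [v - w]addrC E addrC.
by apply: sm_act; apply/quot_piP; rewrite quot_reprK.
Qed.

Fact quot_scaleA a b q : quot_scale a (quot_scale b q) = quot_scale (a * b) q.
Proof. by rewrite -[q]quot_reprK -!quot_piZ scalerA. Qed.

Fact quot_scale1 : left_id 1 quot_scale.
Proof. by move=> q; rewrite -[q]quot_reprK -!quot_piZ scale1r. Qed.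

Fact quot_scaleDr : right_distributive quot_scale +%R.
Proof.
move=> a p q; rewrite -[p]quot_reprK -[q]quot_reprK.
by rewrite -quot_piD -!quot_piZ scalerDr quot_piD.
Qed.

Fact quot_scaleDl q : {morph quot_scale^~ q : a b / a + b}.
Proof.
by move=> a b /=; rewrite -[q]quot_reprK -!quot_piZ scalerDl quot_piD.
Qed.

HB.instance Definition _ := GRing.Zmodule_isLmodule.Build K quot_sort
  quot_scaleA quot_scale1 quot_scaleDr quot_scaleDl.

Fact quot_act_linearl q : linear (quot_act^~ q).
Proof.
move=> a x y; rewrite -[q]quot_reprK -!quot_piact lm_linearl.
by rewrite quot_piD quot_piZ.
Qed.

Fact quot_act_linearr x : linear (quot_act x).
Proof.
move=> a p q; rewrite -[p]quot_reprK -[q]quot_reprK.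
by rewrite -[a *: _]quot_piZ -quot_piD -!quot_piact lm_linearr quot_piD quot_piZ.
Qed.

Fact quot_act_lie x y q :
  quot_act (lie x y) q = quot_act x (quot_act y q) - quot_act y (quot_act x q).
Proof. by rewrite -[q]quot_reprK -!quot_piact lm_lie quot_piD quot_piN. Qed.

Definition quot_module : lie_module :=
  LieModule quot_act_linearl quot_act_linearr quot_act_lie.

End Quotient.
End Modules.

Section Span.
Variables (K : fieldType) (V : lmodType K).

Definition span_of (G : V -> Prop) : {pred V} := fun x =>
  `[< exists n (c : 'I_n -> K) (g : 'I_n -> V),
        (forall i, G (g i)) /\ x = \sum_(i < n) c i *: g i >].

Lemma span_ind (G P : V -> Prop) :
  P 0 -> (forall a u v, P u -> P v -> P (a *: u + v)) ->
  (forall x, G x -> P x) -> forall x, x \in span_of G -> P x.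
Proof.
move=> P0 Plin PG x /asboolP [n [c [g [Gg ->]]]].
apply: big_rec => [//|i u _ Pu]; exact: Plin (PG _ (Gg i)) Pu.
Qed.

Lemma span_closed G : submod_closed (span_of G).
Proof.
split=> [|a u v].
  apply/asboolP; exists 0%N, (fun=> 0), (fun=> 0).
  by split; [case | rewrite big_ord0].
move=> /asboolP [n [c [g [Gg ->]]]] /asboolP [m [d [h [Gh ->]]]].
apply/asboolP; exists (n + m)%N.
exists (fun i => match split i with inl j => a * c j | inr j => d j end).
exists (fun i => match split i with inl j => g j | inr j => h j end).
split=> [i|]; first by case: (split i).
rewrite big_split_ord /= scaler_sumr; congr (_ + _); apply: eq_bigr => i _.
  by rewrite (unsplitK (inl i)) scalerA.
by rewrite (unsplitK (inr i)).
Qed.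

Lemma span_mem (G : V -> Prop) x : G x -> x \in span_of G.
Proof.
move=> Gx; apply/asboolP; exists 1%N, (fun=> 1), (fun=> x).
by rewrite big_ord1 scale1r.
Qed.

End Span.

Lemma lin_0 (K : fieldType) (U V : lmodType K) (f : U -> V) :
  linear f -> f 0 = 0.
Proof. by move=> lf; have := lf (-1) 0 0; rewrite scaler0 addr0 scaleN1r addNr. Qed.

Lemma lin_opp (K : fieldType) (U V : lmodType K) (f : U -> V) :
  linear f -> forall v, f (- v) = - f v.
Proof.
by move=> lf v; have := lf (-1) v 0; rewrite (lin_0 lf) !addr0 !scaleN1r.
Qed.

Lemma subr_swap0 (V : zmodType) (u v : V) : u - v + (v - u) = 0.
Proof. by rewrite addrA addrNK subrr. Qed.

Lemma eq_opp0 (K : numFieldType) (V : lmodType K) (v : V) : v = - v -> v = 0.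
Proof.
move=> /eqP; rewrite -addr_eq0 -mulr2n -scaler_nat.
by rewrite scaler_eq0 pnatr_eq0 => /eqP.
Qed.

Lemma addr_rot (V : zmodType) (u v w : V) : u + v + w = v + w + u.
Proof. by rewrite [RHS]addrC addrA. Qed.

Lemma lin3 (K : fieldType) (V : lmodType K) (a : K) (u v u1 v1 u2 v2 : V) :
  a *: u + v + (a *: u1 + v1) + (a *: u2 + v2)
  = a *: (u + u1 + u2) + (v + v1 + v2).
Proof. by rewrite !scalerDr [RHS]addrACA [a *: u + _ + _]addrACA. Qed.

Lemma lin_sub (K : fieldType) (U V : lmodType K) (f : U -> V) :
  linear f -> forall a b u v, f (a *: u - b *: v) = a *: f u - b *: f v.
Proof.
move=> lf a b u v; rewrite lf -!scaleNr; congr (_ + _).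
by have := lf (- b) v 0; rewrite (lin_0 lf) !addr0.
Qed.

Lemma jacobi_id (K : fieldType) (V : lmodType K) (u v w : V)
    (rj rk si sk ti tj : int) :
  tj%:~R *: ((si + ti)%:~R *: w - rk%:~R *: u)
  - sk%:~R *: ((si + ti)%:~R *: v - rj%:~R *: u)
  + (rk%:~R *: ((tj + rj)%:~R *: u - si%:~R *: v)
     - ti%:~R *: ((tj + rj)%:~R *: w - sk%:~R *: v))
  + (si%:~R *: ((rk + sk)%:~R *: v - tj%:~R *: w)
     - rj%:~R *: ((rk + sk)%:~R *: u - ti%:~R *: w)) = 0.
Proof.
pose c3 (a b c : K) := a *: u + b *: v + c *: w.
have cD a b c a' b' c' : c3 a b c + c3 a' b' c' = c3 (a + a') (b + b') (c + c').
  by rewrite /c3 !scalerDl [LHS]addrACA [a *: u + _ + _]addrACA.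
have cZ a b c d : d *: c3 a b c = c3 (d * a) (d * b) (d * c).
  by rewrite /c3 !scalerDr !scalerA.
have cN a b c : - c3 a b c = c3 (- a) (- b) (- c).
  by rewrite -scaleN1r cZ !mulN1r.
have -> : u = c3 1 0 0 by rewrite /c3 scale1r !scale0r !addr0.
have -> : v = c3 0 1 0 by rewrite /c3 scale1r !scale0r add0r !addr0.
have -> : w = c3 0 0 1 by rewrite /c3 scale1r !scale0r !add0r.
rewrite !(cZ, cN, cD) !intrD; set a := (X in c3 X _ _).
set b := (X in c3 _ X _); set c := (X in c3 _ _ X).
have [-> -> ->] : [/\ a = 0, b = 0 & c = 0] by split; rewrite /a /b /c; ring.
by rewrite /c3 !scale0r !addr0.
Qed.

Lemma lie_partial_div_id (K : fieldType) (V : lmodType K) (u v w : V)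
    (a b c : K) :
  a *: (c *: u - 0%:~R *: w) - b *: (c *: v - 0%:~R *: w)
  = c *: (a *: u - b *: v).
Proof. by rewrite !scale0r !subr0 scalerBr !scalerA ![c * _]mulrC. Qed.

Lemma lie_div_id (K : fieldType) (V : lmodType K) (u v : V)
    (r1 r2 s1 s2 : int) :
  (s2 + 1)%:~R *: ((r2 + 1)%:~R *: (s1%:~R *: u - r1%:~R *: u)
                   - (r1 + 1)%:~R *: (s2%:~R *: u - r1%:~R *: v))
  - (s1 + 1)%:~R *: ((r2 + 1)%:~R *: (s1%:~R *: v - r2%:~R *: u)
                   - (r1 + 1)%:~R *: (s2%:~R *: v - r2%:~R *: v))
  = ((r2 + 1) * (s1 + 1) - (r1 + 1) * (s2 + 1))%:~R *:
    ((r2 + s2 + 1)%:~R *: u - (r1 + s1 + 1)%:~R *: v).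
Proof.
pose c2 (a b : K) := a *: u + b *: v.
have cD a b a' b' : c2 a b + c2 a' b' = c2 (a + a') (b + b').
  by rewrite /c2 !scalerDl addrACA.
have cZ a b d : d *: c2 a b = c2 (d * a) (d * b).
  by rewrite /c2 !scalerDr !scalerA.
have cN a b : - c2 a b = c2 (- a) (- b) by rewrite -scaleN1r cZ !mulN1r.
have -> : u = c2 1 0 by rewrite /c2 scale1r !scale0r !addr0.
have -> : v = c2 0 1 by rewrite /c2 scale1r !scale0r add0r.
by rewrite !(cZ, cN, cD) !(intrD, intrM, intrN); congr c2; ring.
Qed.

Lemma lin_comm (K : fieldType) (V : lmodType K) (a : K) (u v u' v' : V) :
  a *: (u - v) + (u' - v') = a *: u + u' - (a *: v + v').
Proof. by rewrite scalerBr opprD addrACA. Qed.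

Lemma span_rep (K : fieldType) (L : lieAlgType K) (V : lmodType K)
    (G : L -> Prop) (act : L -> V -> V) :
  (forall v, linear (act^~ v)) -> (forall x, linear (act x)) ->
  (forall x y v, G x -> G y ->
     act (lie x y) v = act x (act y v) - act y (act x v)) ->
  forall x y v, x \in span_of G -> y \in span_of G ->
     act (lie x y) v = act x (act y v) - act y (act x v).
Proof.
move=> al ar actG x y v Sx; move: y; apply: span_ind.
- rewrite (lin_0 (lie_linearr x)) !(lin_0 (al _)).
  by rewrite (lin_0 (ar x)) subrr.
- move=> a u u' Eu Ev; rewrite (lie_linearr x) !(al _) Eu Ev (ar x).
  exact: lin_comm.
move=> y Gy; move: x Sx; apply: span_ind.
- rewrite (lin_0 (lie_linearl y)) !(lin_0 (al _)).
  by rewrite (lin_0 (ar y)) subrr.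
- move=> a u u' Eu Ev; rewrite (lie_linearl y) !(al _) Eu Ev (ar y).
  exact: lin_comm.
by move=> x Gx; exact: actG.
Qed.

Section LinearExtension.
Variables (K : fieldType) (I : choiceType) (V : lmodType K).

Definition lext (g : I -> V) (x : malg I K) : V :=
  \sum_(k <- monalg.msupp x) monalg.mcoeff k x *: g k.

Lemma lextEw (g : I -> V) x (d : {fset I}) : (monalg.msupp x `<=` d)%fset ->
  lext g x = \sum_(k <- d) monalg.mcoeff k x *: g k.
Proof.
move=> le; rewrite /lext [RHS](big_fsetID _ (mem (monalg.msupp x))) /=.
rewrite [X in _ = _ + X]big1_fset ?addr0 => [|k].
  apply: eq_fbigl => k; rewrite !inE /=.
  by apply/idP/andP => [h|[]//]; rewrite (fsubsetP le).
by rewrite !inE /= => /andP [_ /monalg.mcoeff_outdom ->]; rewrite scale0r.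
Qed.

Lemma lext_linear g : linear (lext g).
Proof.
move=> a x y; pose d := (monalg.msupp (a *: x + y) `|`
  (monalg.msupp x `|` monalg.msupp y))%fset.
rewrite !(@lextEw _ _ d) /d; try by
  rewrite ?fsubsetUl // fsubsetU // ?fsubsetUl ?fsubsetUr orbT.
rewrite scaler_sumr -big_split /=; apply: eq_bigr => k _.
by rewrite monalg.mcoeffD monalg.mcoeffZ scalerDl scalerA.
Qed.

Lemma lextU g c k : lext g << c *g k >> = c *: g k.
Proof.
rewrite (@lextEw _ _ [fset k]%fset) ?monalg.msuppU_le //.
by rewrite big_seq_fset1 monalg.mcoeffUU.
Qed.

Lemma malg_ind (P : malg I K -> Prop) : P 0 ->
  (forall a u v, P u -> P v -> P (a *: u + v)) ->
  (forall k, P << k >>) -> forall x, P x.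
Proof.
move=> P0 Plin PU x; rewrite [x]monalg.monalgE.
apply: big_rec => [//|k u _ Pu].
have -> : << monalg.mcoeff k x *g k >> = monalg.mcoeff k x *: << k >>.
  apply/monalg.malgP => l.
  by rewrite monalg.mcoeffZ !monalg.mcoeffU; case: eqP; rewrite ?mulr1 ?mulr0.
exact: Plin.
Qed.

Lemma lext_lin_fun a f g x :
  lext (fun k => a *: f k + g k) x = a *: lext f x + lext g x.
Proof.
rewrite /lext scaler_sumr -big_split; apply: eq_bigr => k _ /=.
by rewrite scalerDr !scalerA mulrC.
Qed.

Lemma eq_lext f g x : f =1 g -> lext f x = lext g x.
Proof. by move=> E; apply: eq_bigr => k _; rewrite E. Qed.

End LinearExtension.

Definition Z2 : Type := (int * int)%type.
HB.instance Definition _ := GRing.Zmodule.on Z2.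

Definition coord (r : Z2) (i : 'I_2) : int := if i == 0 then r.1 else r.2.

Lemma coordD r s i : coord (r + s) i = coord r i + coord s i.
Proof. by rewrite /coord; case: ifP. Qed.

(* The Witt algebra A_2 d_1 (+) A_2 d_2 as the vector space with basis
   t^r d_i; the indices 1, 2 of the mathematics are 0, 1 in 'I_2. *)
Definition W2 (K : numFieldType) : Type := malg (Z2 * 'I_2)%type K.
HB.instance Definition _ (K : numFieldType) := GRing.Lmodule.on (W2 K).

HB.lock Definition td (K : numFieldType) (r : Z2) (i : 'I_2) : W2 K :=
  << (r, i) >>.
Arguments td {K} r i.

(* (r_2 + 1) t^r d_1 - (r_1 + 1) t^r d_2 *)
HB.lock Definition divS (K : numFieldType) (r : Z2) : W2 K :=
  (r.2 + 1)%:~R *: td r 0 - (r.1 + 1)%:~R *: td r 1.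
Arguments divS {K} r.

Lemma divSE (K : numFieldType) (r : Z2) : divS r =
  (r.2 + 1)%:~R *: td r 0 - (r.1 + 1)%:~R *: td r 1 :> W2 K.
Proof. by rewrite divS.unlock. Qed.

Section Witt.
Variable K : numFieldType.
Local Notation W2 := (W2 K).

(* [t^r d_i, t^s d_j] = s_i t^(r+s) d_j - r_j t^(r+s) d_i, extended
   bilinearly. *)
Definition witt_basis_bracket (k l : Z2 * 'I_2) : W2 :=
  (coord l.1 k.2)%:~R *: td (k.1 + l.1) l.2
  - (coord k.1 l.2)%:~R *: td (k.1 + l.1) k.2.

Definition witt_bracket (x y : W2) : W2 :=
  lext (fun k => lext (witt_basis_bracket k) y) x.

Lemma lext_td (V : lmodType K) (g : Z2 * 'I_2 -> V) r i :
  lext g (td r i) = g (r, i).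
Proof. rewrite td.unlock; exact: etrans (lextU _ _ _) (scale1r _). Qed.

Fact witt_bracket_linearl y : linear (witt_bracket^~ y).
Proof. by move=> a u v; exact: lext_linear. Qed.

Fact witt_bracket_linearr x : linear (witt_bracket x).
Proof.
move=> a u v; pose f w k := lext (witt_basis_bracket k) w.
transitivity (lext (fun k => a *: f u k + f v k) x).
  by apply: eq_lext => k; exact: lext_linear.
exact: lext_lin_fun.
Qed.

Lemma witt_bracket_td r i s j t : r + s = t -> witt_bracket (td r i) (td s j) =
  (coord s i)%:~R *: td t j - (coord r j)%:~R *: td t i.
Proof. by move<-; rewrite /witt_bracket !lext_td. Qed.

Lemma W2_ind (P : W2 -> Prop) : P 0 ->
  (forall a u v, P u -> P v -> P (a *: u + v)) ->
  (forall r i, P (td r i)) -> forall x, P x.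
Proof. rewrite td.unlock; by move=> P0 Plin Ptd; apply: malg_ind => // -[r i]; exact: Ptd. Qed.

Lemma bilin_ext0 (V : lmodType K) (f : W2 -> W2 -> V) :
  (forall y, linear (f^~ y)) -> (forall x, linear (f x)) ->
  (forall r i s j, f (td r i) (td s j) = 0) -> forall x y, f x y = 0.
Proof.
move=> fl fr f0 x y; elim/W2_ind: x => [|a u v Eu Ev|r i].
- exact: (lin_0 (fl y)).
- by rewrite (fl y) Eu Ev scaler0 addr0.
elim/W2_ind: y => [|a u v Eu Ev|s j]; last exact: f0.
  exact: lin_0 (fr _).
by rewrite (fr _) Eu Ev scaler0 addr0.
Qed.

Lemma witt_bracketC x y : witt_bracket x y = - witt_bracket y x.
Proof.
apply/eqP; rewrite -addr_eq0; apply/eqP; move: x y.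
apply: bilin_ext0 => [y a u v|x a u v|r i s j].
- by rewrite witt_bracket_linearl witt_bracket_linearr scalerDr addrACA.
- by rewrite witt_bracket_linearl witt_bracket_linearr scalerDr addrACA.
rewrite (witt_bracket_td i j (erefl (r + s))).
rewrite (witt_bracket_td j i (addrC s r : _ = r + s)); exact: subr_swap0.
Qed.

Fact witt_bracketxx x : witt_bracket x x = 0.
Proof.
exact: eq_opp0 (witt_bracketC x x).
Qed.

Fact witt_jacobi x y z : witt_bracket x (witt_bracket y z) +
  witt_bracket y (witt_bracket z x) + witt_bracket z (witt_bracket x y) = 0.
Proof.
have [bl br] := (witt_bracket_linearl, witt_bracket_linearr).
pose J x y z : W2 := witt_bracket x (witt_bracket y z) +
  witt_bracket y (witt_bracket z x) + witt_bracket z (witt_bracket x y).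
have JC u v w : J u v w = J v w u := addr_rot _ _ _.
have Jl v w : linear (fun u => J u v w).
  move=> a u u'; rewrite /J (bl _ a u u') (br w a u u') (br v) (bl v a u u') (br w).
  exact: lin3.
suff {x y z} J0 x y z : J x y z = 0 by exact: J0.
move: y z; elim/W2_ind: x => [y z|a u v Eu Ev y z|r i y z].
- exact: (lin_0 (Jl y z)).
- by rewrite (Jl y z) Eu Ev scaler0 addr0.
rewrite JC; move: y z; apply: bilin_ext0 => [y|x|s j t k].
- exact: Jl.
- by move=> a u v /=; rewrite ![J x _ _]JC; exact: Jl.
have [bt Et] := (witt_bracket_td, erefl (r + s + t)).
have rst : r + (s + t) = r + s + t by exact: addrA.
have str : s + (t + r) = r + s + t by rewrite addrA addrC addrA.
have trs : t + (r + s) = r + s + t by exact: addrC.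
rewrite JC JC /J !(bt _ _ _ _ _ (erefl _)) !(lin_sub (br _)).
rewrite !(bt _ _ _ _ _ rst) !(bt _ _ _ _ _ str) !(bt _ _ _ _ _ trs).
rewrite !coordD; exact: jacobi_id.
Qed.

HB.instance Definition _ := Lmodule_isLieAlgebra.Build K W2
  witt_bracket_linearl witt_bracket_linearr witt_bracketxx witt_jacobi.

Inductive S2_gen : W2 -> Prop :=
| S2_gen_partial i : S2_gen (td 0 i)
| S2_gen_div r of r != (-2, -2) : S2_gen (divS r).

Definition S2_mem : {pred W2} := span_of S2_gen.

Fact S2_mem_closed : submod_closed S2_mem.
Proof. exact: span_closed. Qed.
HB.instance Definition _ := GRing.isSubmodClosed.Build K W2 S2_mem S2_mem_closed.

Lemma lie_td r i s j t : r + s = t -> lie (td r i) (td s j) =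
  (coord s i)%:~R *: td t j - (coord r j)%:~R *: td t i.
Proof. exact: witt_bracket_td. Qed.

Lemma lie_partial i j : lie (td 0 i) (td 0 j) = 0.
Proof.
rewrite (lie_td i j (addr0 0)) /coord.
by case: ifP; case: ifP; rewrite !scale0r subrr.
Qed.

Lemma lie_partial_div i r : lie (td 0 i) (divS r) = (coord r i)%:~R *: divS r.
Proof.
rewrite !divSE (lin_sub (lie_linearr _)) !(lie_td _ _ (add0r r)).
have c0 j : coord 0 j = 0 by rewrite /coord; case: ifP.
rewrite !c0; exact: lie_partial_div_id.
Qed.

Definition lie_coef (r s : Z2) : int :=
  (r.2 + 1) * (s.1 + 1) - (r.1 + 1) * (s.2 + 1).

Lemma lie_div r s :
  lie (divS r) (divS s) = (lie_coef r s)%:~R *: divS (r + s).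
Proof.
rewrite !divSE (lin_sub (lie_linearr _)) !(lin_sub (lie_linearl _)).
rewrite !(lie_td _ _ (erefl (r + s))).
exact: lie_div_id.
Qed.

Lemma lieC (x y : W2) : lie x y = - lie y x.
Proof. exact: witt_bracketC. Qed.

Fact S2_lie x y : x \in S2_mem -> y \in S2_mem -> lie x y \in S2_mem.
Proof.
have [S0 Sl] := S2_mem_closed.
have SZ a u : u \in S2_mem -> a *: u \in S2_mem.
  by move=> Su; rewrite -[a *: u]addr0; exact: Sl.
have Sg g : S2_gen g -> g \in S2_mem by exact: span_mem.
move=> Sx; move: y; apply: span_ind.
- by rewrite (lin_0 (lie_linearr x)).
- by move=> a u v; rewrite lie_linearr; exact: Sl.
move=> y Gy; move: x Sx; apply: span_ind.
- by rewrite (lin_0 (lie_linearl y)).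
- by move=> a u v; rewrite lie_linearl; exact: Sl.
move=> _ [i|r nr].
  case: Gy => [j|s ns]; first by rewrite lie_partial.
  by rewrite lie_partial_div; apply: SZ; apply: Sg; constructor.
case: Gy => [j|s ns].
  rewrite lieC lie_partial_div -scaleNr.
  by apply: SZ; apply: Sg; constructor.
rewrite lie_div; have [rs|nrs] := eqVneq (r + s) (-2, -2); last first.
  by apply: SZ; apply: Sg; constructor.
suff -> : lie_coef r s = 0 by rewrite scale0r.
case: r s rs {nr ns} => [r1 r2] [s1 s2] [] e1 e2; rewrite /lie_coef /=.
have -> : s1 = -2 - r1 by rewrite -e1 addrC addKr.
have -> : s2 = -2 - r2 by rewrite -e2 addrC addKr.
ring.
Qed.

Record S2bar := S2Bar { S2val :> W2; S2valP : S2val \in S2_mem }.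
HB.instance Definition _ := [isSub for S2val].
HB.instance Definition _ := [Choice of S2bar by <:].
HB.instance Definition _ := [SubChoice_isSubLmodule of S2bar by <:].

Definition S2_bracket (x y : S2bar) : S2bar :=
  S2Bar (S2_lie (S2valP x) (S2valP y)).

Fact S2_bracket_linearl y : linear (S2_bracket^~ y).
Proof. by move=> a u v; apply: val_inj; exact: lie_linearl. Qed.
Fact S2_bracket_linearr x : linear (S2_bracket x).
Proof. by move=> a u v; apply: val_inj; exact: lie_linearr. Qed.
Fact S2_bracketxx x : S2_bracket x x = 0.
Proof. by apply: val_inj; exact: liexx. Qed.
Fact S2_jacobi x y z : S2_bracket x (S2_bracket y z) +
  S2_bracket y (S2_bracket z x) + S2_bracket z (S2_bracket x y) = 0.
Proof. by apply: val_inj; exact: lie_jacobi. Qed.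

HB.instance Definition _ := Lmodule_isLieAlgebra.Build K S2bar
  S2_bracket_linearl S2_bracket_linearr S2_bracketxx S2_jacobi.

Definition S2_partial (i : 'I_2) : S2bar :=
  S2Bar (span_mem (S2_gen_partial i)).
Definition S2_div (r : Z2) (nr : r != (-2, -2)) : S2bar :=
  S2Bar (span_mem (S2_gen_div nr)).

End Witt.

Arguments S2_mem {K}.
Arguments S2_partial {K} i.
Arguments S2_div {K} [r] nr.

Section Omega.
Variables (K : numFieldType) (lam1 lam2 kappa : K).
Hypotheses (nz1 : lam1 != 0) (nz2 : lam2 != 0).
Local Notation P := {mpoly K[2]}.

Definition lamX (r : Z2) : K := lam1 ^ r.1 * lam2 ^ r.2.

(* f(h_1 - r_1, h_2 - r_2), with h_1 = 'X_0 and h_2 = 'X_1. *)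
Definition shift (r : Z2) (f : P) : P :=
  f \mPo [tuple 'X_0 - (r.1)%:~R; 'X_1 - (r.2)%:~R].

Lemma lamXD r s : lamX (r + s) = lamX r * lamX s.
Proof. by rewrite /lamX !expfzDr // mulrACA. Qed.

Lemma lamX0 : lamX 0 = 1.
Proof. by rewrite /lamX !expr0z mulr1. Qed.

Lemma shiftX r i : shift r 'X_i = 'X_i - (coord r i)%:~R.
Proof.
rewrite /shift comp_mpolyXU /coord; case: i => [[|[|//]] lti] /=;
by congr ('X_ _ - _); apply: val_inj.
Qed.

Lemma shiftM r f g : shift r (f * g) = shift r f * shift r g.
Proof. exact: rmorphM. Qed.

Lemma shiftD r f g : shift r (f + g) = shift r f + shift r g.
Proof. exact: rmorphD. Qed.

Lemma shiftN r f : shift r (- f) = - shift r f.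
Proof. exact: rmorphN. Qed.

Lemma shift_int r n : shift r n%:~R = n%:~R.
Proof. exact: rmorph_int. Qed.

Lemma shiftC r c : shift r c%:MP = c%:MP.
Proof. exact: comp_mpolyC. Qed.

Lemma shiftZ r c f : shift r (c *: f) = c *: shift r f.
Proof. exact: linearZ. Qed.

Lemma mpoly_morph_eq (A : comNzRingType) (f g : P -> A) :
  {morph f : u v / u + v} -> {morph f : u v / u * v} -> f 1 = 1 ->
  {morph g : u v / u + v} -> {morph g : u v / u * v} -> g 1 = 1 ->
  (forall c, f c%:MP = g c%:MP) -> (forall i, f 'X_i = g 'X_i) -> f =1 g.
Proof.
move=> fD fM f1 gD gM g1 fgC fgX; elim/mpolyind => [|c m p _ _ IH].
  by rewrite -mpolyC0 fgC.
rewrite fD gD IH -mul_mpolyC fM gM fgC; congr (_ * _ + _).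
rewrite mpolyXE_id (big_morph f fM f1) (big_morph g gM g1).
apply: eq_bigr => i _; elim: (m i) => [|k IHk]; first by rewrite !expr0 f1 g1.
by rewrite !exprS fM gM fgX IHk.
Qed.

Lemma shift0 f : shift 0 f = f.
Proof.
move: f; apply: mpoly_morph_eq => // [u v|u v||c|i].
- exact: shiftD.
- exact: shiftM.
- exact: shift_int 0 1.
- exact: shiftC.
by rewrite shiftX /coord; case: ifP; rewrite subr0.
Qed.

Lemma shift_shift r s f : shift r (shift s f) = shift (r + s) f.
Proof.
move: f; apply: mpoly_morph_eq => [u v|u v||u v|u v||c|i].
- by rewrite !shiftD.
- by rewrite !shiftM.
- by rewrite !(shift_int _ 1).
- exact: shiftD.
- exact: shiftM.
- exact: shift_int _ 1.
- by rewrite !shiftC.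
by rewrite !shiftX shiftD shiftX shiftN shift_int coordD intrD opprD addrA.
Qed.

Lemma shift_shiftC r s f : shift s (shift r f) = shift (r + s) f.
Proof. by rewrite shift_shift; congr shift; exact: addrC. Qed.

(* Value of t^r d_i on f; extended linearly to W2 and restricted to S2bar it
   is the action of Omega, which is pinned down by [Omega_partial] and
   [Omega_div].  Indeed, if a1 = c (r_2 + 1) and a2 = - c (r_1 + 1), then
   c ((r_2+1) h_1 - (r_1+1) h_2 + (r_1-r_2) kappa)
     = a1 (h_1 - kappa) + a2 (h_2 - kappa),
   while d_1 and d_2 (r = 0) act by h_1 and h_2.  It is not an action of the
   whole of W2. *)
Definition omega_basis (k : Z2 * 'I_2) (f : P) : P :=
  if k.1 == 0 then 'X_(k.2) * f
  else lamX k.1 *: (('X_(k.2) - kappa%:MP) * shift k.1 f).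

Definition omega_actW (x : W2 K) (f : P) : P := lext (omega_basis^~ f) x.

Definition omega_coef (r : Z2) : P :=
  (r.2 + 1)%:~R *: 'X_0 - (r.1 + 1)%:~R *: 'X_1 + ((r.1 - r.2)%:~R * kappa)%:MP.

Fact omega_actW_linearl f : linear (omega_actW^~ f).
Proof. by move=> a x y; exact: lext_linear. Qed.

Fact omega_basis_linear k : linear (omega_basis k).
Proof.
move=> a f g; rewrite /omega_basis; case: (k.1 == 0).
  by rewrite mulrDr scalerAr.
by rewrite shiftD shiftZ mulrDr -scalerAr scalerDr !scalerA [a * _]mulrC.
Qed.

Fact omega_actW_linearr x : linear (omega_actW x).
Proof.
move=> a f g; transitivity
  (lext (fun k => a *: omega_basis k f + omega_basis k g) x).
  by apply: eq_lext => k; exact: omega_basis_linear.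
exact: lext_lin_fun.
Qed.

Lemma omega_actW_partial i f : omega_actW (td 0 i) f = 'X_i * f.
Proof. by rewrite /omega_actW lext_td /omega_basis /= ?eqxx. Qed.

Lemma omega_actW_div r f :
  omega_actW (divS r) f = lamX r *: (omega_coef r * shift r f).
Proof.
rewrite divSE (lin_sub (omega_actW_linearl f)) /omega_actW !lext_td.
rewrite /omega_basis /=; case: eqP => [->|_].
  rewrite lamX0 shift0 scale1r /omega_coef.
  rewrite (_ : (0 : Z2).1 = 0) // (_ : (0 : Z2).2 = 0) //.
  by rewrite !add0r oppr0 mul0r !scale1r mpolyC0 addr0 mulrBl.
rewrite !scalerA ![_ * lamX r]mulrC -!scalerA -scalerBr; congr (_ *: _).
rewrite /omega_coef !scalerAl -mulrBl; congr (_ * _).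
rewrite !scalerBr -!mul_mpolyC !mpolyCM !rmorph_int; ring.
Qed.

Lemma shift_coef r s : shift r (omega_coef s) =
  omega_coef s - ((s.2 + 1) * r.1 - (s.1 + 1) * r.2)%:~R.
Proof.
rewrite /omega_coef !shiftD shiftN !shiftZ !shiftX shiftC /coord /=.
rewrite -!mul_mpolyC !mpolyCM !rmorph_int; ring.
Qed.

Lemma omega_lie_partial_div i r f : omega_actW (lie (td 0 i) (divS r)) f =
  omega_actW (td 0 i) (omega_actW (divS r) f)
  - omega_actW (divS r) (omega_actW (td 0 i) f).
Proof.
rewrite lie_partial_div -[_ *: divS r]addr0 omega_actW_linearl.
rewrite (lin_0 (omega_actW_linearl f)) addr0.
rewrite !omega_actW_partial !omega_actW_div shiftM shiftX -scalerAr -scalerBr.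
rewrite scalerA mulrC -scalerA; congr (_ *: _).
rewrite -mul_mpolyC rmorph_int; ring.
Qed.

Lemma omega_lie_div r s f : omega_actW (lie (divS r) (divS s)) f =
  omega_actW (divS r) (omega_actW (divS s) f)
  - omega_actW (divS s) (omega_actW (divS r) f).
Proof.
rewrite lie_div -[_ *: divS _]addr0 omega_actW_linearl.
rewrite (lin_0 (omega_actW_linearl f)) addr0.
rewrite !omega_actW_div !shiftZ !shiftM lamXD.
rewrite (shift_shift r s) [shift s (shift r f)]shift_shiftC.
rewrite -!scalerAr !scalerA [lamX s * lamX r]mulrC -scalerBr.
rewrite mulrC -scalerA; congr (_ *: _).
rewrite !shift_coef -mul_mpolyC rmorph_int !mulrA -mulrBl; congr (_ * _).
rewrite /lie_coef /omega_coef /= -!mul_mpolyC !mpolyCM !rmorph_int; ring.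
Qed.

Lemma omega_lie x y f : x \in S2_mem -> y \in S2_mem ->
  omega_actW (lie x y) f =
  omega_actW x (omega_actW y f) - omega_actW y (omega_actW x f).
Proof.
apply: span_rep; [exact: omega_actW_linearl|exact: omega_actW_linearr|].
move=> {}x {}y {}f Gx Gy; case: Gx => [i|r nr]; case: Gy => [j|s ns].
- rewrite lie_partial (lin_0 (omega_actW_linearl f)) !omega_actW_partial.
  by rewrite mulrCA subrr.
- exact: omega_lie_partial_div.
- rewrite lieC (lin_opp (omega_actW_linearl f)) omega_lie_partial_div.
  exact: opprB.
exact: omega_lie_div.
Qed.

Definition omega_act (x : S2bar K) (f : P) : P := omega_actW (S2val x) f.

Fact omega_act_linearl f : linear (omega_act^~ f).
Proof. by move=> a x y; exact: omega_actW_linearl. Qed.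

Fact omega_act_linearr x : linear (omega_act x).
Proof. exact: omega_actW_linearr. Qed.

Fact omega_act_lie x y f :
  omega_act (lie x y) f = omega_act x (omega_act y f) - omega_act y (omega_act x f).
Proof. exact: omega_lie (S2valP x) (S2valP y). Qed.

Definition Omega : lie_module (S2bar K) :=
  LieModule omega_act_linearl omega_act_linearr omega_act_lie.

Lemma Omega_partial i (f : P) : @lm_act _ _ Omega (S2_partial i) f = 'X_i * f.
Proof. exact: omega_actW_partial. Qed.

Lemma Omega_div r (nr : r != (-2, -2)) (f : P) :
  @lm_act _ _ Omega (S2_div nr) f =
  (lam1 ^ r.1 * lam2 ^ r.2) *:
   (((r.2 + 1)%:~R *: 'X_0 - (r.1 + 1)%:~R *: 'X_1
     + ((r.1 - r.2)%:~R * kappa)%:MP)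
    * (f \mPo [tuple 'X_0 - (r.1)%:~R; 'X_1 - (r.2)%:~R])).
Proof. exact: omega_actW_div. Qed.

Definition ideal2 (p q : P) : {pred P} := fun f =>
  `[< exists a b : P, f = a * p + b * q >].

Definition Omega'_pred : {pred P} :=
  ideal2 ('X_0 - kappa%:MP) ('X_1 - kappa%:MP).

Fact Omega'_closed : submod_closed (Omega'_pred : {pred Omega}).
Proof.
split=> [|a u v].
  by apply/asboolP; exists 0, 0; rewrite !mul0r addr0.
move=> /asboolP [b [c ->]] /asboolP [d [e ->]]; apply/asboolP.
exists (a *: b + d), (a *: c + e).
by rewrite scalerDr !mulrDl !scalerAl addrACA.
Qed.

Fact Omega'_act x (f : Omega) :
  f \in Omega'_pred -> lm_act x f \in Omega'_pred.
Proof.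
have [O0 Ol] := Omega'_closed.
move=> Of; move: (S2valP x).
suff: forall y : W2 K, y \in S2_mem -> omega_actW y f \in Omega'_pred.
  by move=> H /H.
apply: span_ind => [|a u v Eu Ev|_ [i|r _]].
- by rewrite (lin_0 (omega_actW_linearl f)).
- by rewrite omega_actW_linearl; exact: Ol.
- rewrite omega_actW_partial; move: Of => /asboolP [b [c ->]].
  by apply/asboolP; exists ('X_i * b), ('X_i * c); rewrite mulrDr !mulrA.
rewrite omega_actW_div; apply/asboolP.
exists (lamX r *: ((r.2 + 1)%:~R * shift r f)).
exists (lamX r *: (- (r.1 + 1)%:~R * shift r f)).
rewrite -!scalerAl -scalerDr; congr (_ *: _).
rewrite /omega_coef -!mul_mpolyC !mpolyCM !rmorph_int; ring.
Qed.

Definition Omega' : submodule Omega := Submodule Omega'_closed Omega'_act.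

End Omega.

(* Main.v *)
(* Every nonzero submodule N contains Omega'.  N is an ideal of C[h1, h2], and
   for f in N it contains, with x = h1 - kappa and y = h2 - kappa,
     ((r2 + 1) x - (r1 + 1) y) f(h1 - r1, h2 - r2)
   for all natural r1, r2.  This is polynomial in (r1, r2), so all its
   coefficients in r1, r2 lie in N.  The top one for the lexicographic order
   with r1 first is a nonzero multiple of y, the one with r2 first a nonzero
   multiple of x.  On the quotient, evaluation at (kappa, kappa) is an
   isomorphism to C. *)
Require Import Defs.
From mathcomp Require Import all_boot all_order all_algebra.
From mathcomp Require Import reals complex.
From HB Require Import structures.
From mathcomp Require Import generic_quotient boolp mpoly ring.

Set Implicit Arguments.
Unset Strict Implicit.
Unset Printing Implicit Defensive.

Import GRing.Theory Num.Theory.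
Local Open Scope ring_scope.

(** * Coefficients of polynomials whose values at the naturals lie in a subspace *)

Section CoefficientsFromValues.
Variables (K : numFieldType) (A : comAlgType K) (W : {pred A}).
Hypothesis Wclosed : submod_closed W.

Lemma submod_closed_scale a u : u \in W -> a *: u \in W.
Proof.
by case: Wclosed => W0 Wl Wu; rewrite -[a *: u]addr0; exact: Wl.
Qed.

Lemma submod_closed_add u v : u \in W -> v \in W -> u + v \in W.
Proof. by case: Wclosed => _ Wl Wu Wv; rewrite -[u]scale1r; exact: Wl. Qed.

(* Inverting the Vandermonde matrix of the nodes 0, 1, ..., size q - 1 writes
   each coefficient of q as a K-linear combination of values of q. *)
Lemma coef_in_of_horner_nat_in (q : {poly A}) :
  (forall n : nat, q.[n%:R] \in W) -> forall i, q`_i \in W.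
Proof.
move=> Wq i; have [W0 _] := Wclosed.
have [lt_i|le_i] := ltnP i (size q); last by rewrite nth_default.
pose V := Vandermonde (size q) (\row_(n < size q) (n%:R : K)).
have Vunit : V \in unitmx.
  rewrite unitmxE det_Vandermonde unitfE; apply/prodf_neq0 => j _.
  apply/prodf_neq0 => k lt_jk.
  by rewrite !mxE subr_eq0 eqr_nat neq_ltn lt_jk orbT.
pose I := Ordinal lt_i.
suff -> : q`_i = \sum_(n < size q) invmx V n I *: q.[n%:R].
  apply: (big_ind (fun u => u \in W)) => //; first exact: submod_closed_add.
  by move=> n _; exact: submod_closed_scale.
have term (n j : 'I_(size q)) :
    invmx V n I *: (q`_j * n%:R ^+ j) = (V j n * invmx V n I) *: q`_j.
  rewrite !mxE -!natrX mulr_natr -scaler_nat scalerA.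
  by rewrite [_%:R * _]mulrC.
under eq_bigr do rewrite horner_coef scaler_sumr.
rewrite exchange_big (bigD1 I) // [X in _ = _ + X]big1 => [|j /andP [_ neq_j]]; last first.
  under eq_bigr do rewrite term.
  have /matrixP/(_ j I) := mulmxV Vunit; rewrite !mxE (negPf neq_j) => VI.
  by rewrite -scaler_suml VI scale0r.
  rewrite addr0; under eq_bigr do rewrite (term _ I).
have /matrixP/(_ I I) := mulmxV Vunit; rewrite !mxE eqxx mulr1n => VI.
by rewrite -scaler_suml VI scale1r.
Qed.

(** The product is the value at $n$ of a polynomial of degree at most $d+1$ whose coefficient at
    $d+1$ is, up to the sign $(-1)^d$, the element in the conclusion. *)
Lemma top_coef_in (I : eqType) (s : seq I) (b : I -> A) (e : I -> nat)
    (a c0 c1 : A) (d : nat) :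
  (forall i, i \in s -> (e i <= d)%N) ->
  (forall n : nat,
     (c0 + n%:R * c1) * (\sum_(i <- s) b i * (a - n%:R) ^+ e i) \in W) ->
  c1 * (\sum_(i <- s | e i == d) b i) \in W.
Proof.
move=> le_e WF.
(* The signs express $(a-n)^{e_i}$ through the monic $X-a$, which makes the coefficients at index
   $d$ and above explicit. *)
pose S := \sum_(i <- s) ((-1) ^+ e i * b i) *: ('X - a%:P) ^+ e i : {poly A}.
have coefS k : (d <= k)%N ->
    S`_k = \sum_(i <- s | e i == k) (-1) ^+ k * b i.
  move=> le_dk; rewrite coef_sum [RHS]big_mkcond.
  apply: eq_big_seq => i /le_e le_ed; rewrite coefZ.
  case: eqP => [<-|/eqP neq_ek].
    have /monicP := monic_exp (e i) (monicXsubC a).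
    by rewrite lead_coefE size_exp_XsubC => ->; rewrite mulr1.
  rewrite nth_default ?mulr0 // size_exp_XsubC ltn_neqAle neq_ek.
  exact: leq_trans le_dk.
pose q := (c0%:P + 'X * c1%:P) * S.
have Wq n : q.[n%:R] \in W.
  rewrite !hornerE /S horner_sum.
  rewrite (_ : \sum_(i <- s) _ = \sum_(i <- s) b i * (a - n%:R) ^+ e i) //.
  apply: eq_bigr => i _; rewrite !hornerE.
  by rewrite -[a - _]opprB [in RHS]exprNn mulrCA mulrA.
have := coef_in_of_horner_nat_in Wq d.+1.
rewrite /q mulrDl coefD coefCM -mulrA coefXM coefCM /= !coefS //.
(* [c0] meets only the coefficient of [S] at $d+1$, an empty sum because every exponent is at most
   $d$. *)
rewrite [X in c0 * X]big1_seq => [|i /andP [/eqP ei /le_e]]; last first.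
  by rewrite ei ltnn.
rewrite mulr0 add0r -mulr_sumr => /(submod_closed_scale ((-1) ^+ d)).
rewrite mulrCA -!(signr_odd _ d).
by case: (odd d); rewrite ?(scaleN1r, mulN1r, opprK, scale1r, mul1r).
Qed.

End CoefficientsFromValues.

Lemma seq_argmax (T : eqType) (g : T -> nat) (s : seq T) :
  s != [::] -> exists2 m, m \in s & forall k, k \in s -> (g k <= g m)%N.
Proof.
elim: s => [//|x s IH] _; have [->|/IH [m ms mmax]] := eqVneq s [::].
  by exists x => [|k]; rewrite !inE // => /eqP ->.
have [le|lt] := leqP (g x) (g m).
  exists m; first by rewrite inE ms orbT.
  by move=> k; rewrite inE => /predU1P [->|/mmax].
exists x; first by rewrite inE eqxx.
move=> k; rewrite inE => /predU1P [->//|/mmax le].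
exact: leq_trans le (ltnW lt).
Qed.

Lemma ord2_cases (i j k : 'I_2) : i != j -> k = i \/ k = j.
Proof.
by case: i j k => [[|[|//]] ?] [[|[|//]] ?] [[|[|//]] ?] // _;
  (try by left; apply: val_inj); right; apply: val_inj.
Qed.

(** * Polynomials in two variables: leading monomials and evaluation *)

Section TwoVariables.
Variable K : numFieldType.
Local Notation P := {mpoly K[2]}.

(* Only the lexicographically leading monomial of f, with X_i first, contributes
   to the top coefficient in n followed by the top coefficient in k. *)
Lemma slope_in_of_shifts_in (W : {pred P}) (i j : 'I_2) (f : P)
    (c0 : nat -> P) (c1 : P) :
  submod_closed W -> i != j -> f != 0 ->
  (forall n k : nat, (c0 k + n%:R * c1) *
     (\sum_(m <- msupp f) f@_m *:
        (('X_j - k%:R) ^+ m j * ('X_i - n%:R) ^+ m i)) \in W) ->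
  c1 \in W.
Proof.
move=> Wc neq_ij f0 Wf.
have /(seq_argmax (fun m : 'X_{1..2} => m i)) [m1 m1s m1max] : msupp f != [::].
  by rewrite msupp_eq0.
pose s := [seq m : 'X_{1..2} <- msupp f | m i == m1 i].
have /(seq_argmax (fun m : 'X_{1..2} => m j)) [m2 m2s m2max] : s != [::].
  by apply/eqP => s0; have : m1 \in s by [rewrite mem_filter eqxx]; rewrite s0.
have W1 k : c1 * (\sum_(m <- s) (f@_m)%:MP * ('X_j - k%:R) ^+ m j) \in W.
  rewrite big_filter.
  apply: (top_coef_in Wc (a := 'X_i) (c0 := c0 k) m1max) => n.
  rewrite (_ : \sum_(m <- _) _ = \sum_(m <- msupp f) f@_m *:
    (('X_j - k%:R) ^+ m j * ('X_i - n%:R) ^+ m i)) //.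
  by apply: eq_bigr => m _; rewrite -mulrA mul_mpolyC.
have : c1 * (\sum_(m <- s | m j == m2 j) (f@_m)%:MP) \in W.
  (* No linear factor in $k$ is present, so one is supplied: $k$ times an element of [W] is again in
     [W]. *)
  apply: (top_coef_in Wc (a := 'X_j) (c0 := 0) m2max) => k.
  rewrite add0r -mulrA mulr_natl -scaler_nat.
  exact: (submod_closed_scale Wc).
(* Two exponents determine the monomial, so [m2] is the only one left; its coefficient in [f] is
   nonzero and can be divided out. *)
rewrite -big_filter (_ : filter _ s = [:: m2]).
  rewrite big_seq1 mulrC mul_mpolyC => /(submod_closed_scale Wc (f@_m2)^-1).
  move: m2s; rewrite mem_filter => /andP [_]; rewrite mcoeff_msupp => fm2.
  by rewrite scalerA mulVf // scale1r.
rewrite -filter_predI; apply: perm_small_eq => //; apply: uniq_perm => //.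
  exact/filter_uniq/msupp_uniq.
move=> m; rewrite mem_filter inE /=.
move: m2s; rewrite mem_filter => /andP [/eqP m2i m2f].
apply/idP/eqP => [|->]; last by rewrite eqxx m2i eqxx.
case/andP => /andP [/eqP mj /eqP mi] _; apply/mnmP => k.
have [->|->] : k = i \/ k = j; last 2 first.
- by rewrite mi m2i.
- by [].
exact: ord2_cases.
Qed.

(** Since $\partial_i$ acts as multiplication by $h_i$, this makes every submodule an ideal. *)
Lemma mul_in_of_mulX_in n (W : {pred {mpoly K[n]}}) :
  submod_closed W -> (forall i f, f \in W -> 'X_i * f \in W) ->
  forall a f, f \in W -> a * f \in W.
Proof.
move=> Wc WX; have [W0 Wl] := Wc.
suff WXm (m : 'X_{1..n}) f : f \in W -> 'X_[m] * f \in W.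
  elim/mpolyind => [|c m p _ _ IH] f Wf; first by rewrite mul0r.
  by rewrite mulrDl -scalerAl; apply: Wl; [exact: WXm | exact: IH].
move=> Wf; rewrite mpolyXE_id; move: f Wf.
apply: (big_ind (fun g => forall f, f \in W -> g * f \in W)) => [f|g h Wg Wh f Wf|i _ f Wf].
- by rewrite mul1r.
- by rewrite -mulrA; apply: Wg; exact: Wh.
elim: (m i) => [|k IH]; first by rewrite mul1r.
by rewrite exprS -mulrA; exact: WX.
Qed.

(** The polynomials with this property contain the constants and the variables and are closed under
    sums and products. *)
Lemma sub_meval_in_ideal2 (kappa : K) (f : P) :
  f - (f.@[fun=> kappa])%:MP \in ideal2 ('X_0 - kappa%:MP) ('X_1 - kappa%:MP).
Proof.
set p := 'X_0 - _; set q := 'X_1 - _.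
pose good (f : P) := exists a b, f = a * p + b * q + (f.@[fun=> kappa])%:MP.
suff: good f.
  by case=> a [b E]; apply/asboolP; exists a, b; rewrite {1}E addrK.
have goodM g h : good g -> good h -> good (g * h).
  move=> [a [b E]] [a' [b' E']]; rewrite /good mevalM mpolyCM.
  set u := (g.@[_])%:MP in E *; set v := (h.@[_])%:MP in E' *.
  rewrite {1}E {1}E'.
  (* From $gh=(ap+bq)h+u(a'p+b'q)+uv$, with $h$ written out. *)
  exists (a * (a' * p + b' * q + v) + u * a'), (b * (a' * p + b' * q + v) + u * b').
  ring.
have good1 : good 1.
  by exists 0, 0; rewrite !mul0r !add0r meval1 mpolyC1.
have goodX i : good 'X_i.
  rewrite /good mevalXU.
  case: i => [[|[|//]] lti].
    exists 1, 0; rewrite mul1r mul0r addr0 /p subrK; congr 'X_ _.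
    exact: val_inj.
  exists 0, 1; rewrite mul1r mul0r add0r /q subrK; congr 'X_ _.
  exact: val_inj.
elim/mpolyind: f => [|c m g _ _ [a [b E]]].
  by exists 0, 0; rewrite !mul0r !add0r meval0 mpolyC0.
have [a' [b' E']] : good 'X_[m].
  rewrite mpolyXE_id; apply: (big_ind good) => // i _.
  elim: (m i) => [|k IH]; first by rewrite expr0.
  by rewrite exprS; exact: goodM.
exists (c%:MP * a' + a), (c%:MP * b' + b).
rewrite mevalD mevalZ mpolyCD mpolyCM -mul_mpolyC {1}E {1}E'; ring.
Qed.

End TwoVariables.

(** * Submodules of $\Omega$ and the quotient by $\Omega'$ *)

Section OmegaSubmodules.
Variables (K : numFieldType) (lam1 lam2 kappa : K).
Hypotheses (nz1 : lam1 != 0) (nz2 : lam2 != 0).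
Local Notation P := {mpoly K[2]}.
Local Notation Omega := (Omega kappa nz1 nz2).
Local Notation Omega' := (Omega' kappa nz1 nz2).

(** Both generators vanish at $(\kappa,\kappa)$; conversely a polynomial minus its value there lies
    in the ideal. *)
Lemma Omega'P (f : Omega) :
  reflect ((f : P).@[fun=> kappa] = 0) (f \in Omega').
Proof.
apply: (iffP (asboolP _)) => [[a [b ->]]|f0].
  by rewrite mevalD !mevalM !mevalB !mevalXU !mevalC !subrr !mulr0 addr0.
by have /asboolP := sub_meval_in_ideal2 kappa f; rewrite f0 mpolyC0 subr0.
Qed.

(** This is the action of the generator at $r=(n,k)$, never $(-2,-2)$ for natural entries, divided
    by the nonzero scalar $\lambda_1^n\lambda_2^k$. *)
Lemma submodule_coef_shift (N : submodule Omega) (f : P) (n k : nat) :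
  (f : Omega) \in N ->
  omega_coef kappa (n%:Z, k%:Z) *
    (\sum_(m <- msupp f) f@_m *: (('X_0 - n%:R) ^+ m 0 * ('X_1 - k%:R) ^+ m 1))
  \in (N : {pred P}).
Proof.
move=> Nf; have nr : ((n%:Z, k%:Z) : Z2) != (-2, -2) by [].
have := sm_act (S2_div nr) Nf.
rewrite Omega_div => /(submod_closed_scale (sm_closed N)
  (lam1 ^ n%:Z * lam2 ^ k%:Z)^-1).
rewrite scalerA mulVf ?mulf_neq0 ?expfz_neq0 // scale1r comp_mpolyE.
under eq_bigr => m _.
  rewrite !big_ord_recl big_ord0 mulr1 (_ : lift ord0 ord0 = 1); last first.
    exact: val_inj.
  over.
by [].
Qed.

Lemma Omega'_subset (N : submodule Omega) (f : Omega) :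
  f \in N -> f != 0 -> {subset Omega' <= N}.
Proof.
move=> Nf f0; have Nc := sm_closed N.
have coefE (n k : nat) : omega_coef kappa (n%:Z, k%:Z) =
   (k%:R + 1) * ('X_0 - kappa%:MP) - (n%:R + 1) * ('X_1 - kappa%:MP).
  rewrite /omega_coef -!mul_mpolyC !mpolyCM !rmorph_int /=.
  rewrite !intrD !intrN -!pmulrn; ring.
have N1 : 'X_1 - kappa%:MP \in (N : {pred P}).
  (* As a polynomial in $r_1$ the linear factor has slope $-(h_2-\kappa)$, hence the change of
     sign. *)
  rewrite -[_ - _]opprK -[- - _]scaleN1r; apply: (submod_closed_scale Nc).
  apply: (@slope_in_of_shifts_in _ N 0 1 f (fun k =>
    (k%:R + 1) * ('X_0 - kappa%:MP) - ('X_1 - kappa%:MP))) => // n k.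
  have := submodule_coef_shift n k Nf; rewrite coefE.
  under eq_bigr do rewrite mulrC.
  by rewrite (_ : _ - (n%:R + 1) * _ =
    (k%:R + 1) * ('X_0 - kappa%:MP) - ('X_1 - kappa%:MP)
    + n%:R * - ('X_1 - kappa%:MP)) //; ring.
have N0 : 'X_0 - kappa%:MP \in (N : {pred P}).
  (* Now $r_2$ varies first, and the slope is $h_1-\kappa$. *)
  apply: (@slope_in_of_shifts_in _ N 1 0 f (fun k =>
    ('X_0 - kappa%:MP) - (k%:R + 1) * ('X_1 - kappa%:MP))) => // n k.
  have := submodule_coef_shift k n Nf; rewrite coefE.
  by rewrite (_ : (n%:R + 1) * _ - _ =
    ('X_0 - kappa%:MP) - (k%:R + 1) * ('X_1 - kappa%:MP)
    + n%:R * ('X_0 - kappa%:MP)) //; ring.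
have NM : forall a g : P, g \in (N : {pred P}) -> a * g \in (N : {pred P}).
  apply: mul_in_of_mulX_in => // i g Ng.
  by rewrite -(Omega_partial kappa nz1 nz2); exact: sm_act.
move=> g /asboolP [a [b ->]].
by apply: (submod_closed_add Nc); exact: NM.
Qed.

Lemma Omega'_neq0 : exists2 v, v \in Omega' & v != 0.
Proof.
exists ('X_0 - kappa%:MP); first by apply/Omega'P; rewrite mevalB mevalXU mevalC subrr.
(* At $(\kappa+1,\kappa+1)$ the polynomial $h_1-\kappa$ takes the value 1. *)
apply/eqP => /(congr1 (meval (fun=> kappa + 1))).
rewrite mevalB mevalXU mevalC meval0 addrAC subrr add0r => /eqP.
by rewrite oner_eq0.
Qed.

Lemma Omega'_irreducible : irreducible Omega'.
Proof.
split=> [|N sub]; first exact: Omega'_neq0.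
have [[v Nv v0]|N0] := pselect (exists2 v, v \in N & v != 0).
  by right=> u; apply/idP/idP; [exact: sub | exact: (Omega'_subset Nv)].
left=> v Nv; apply/eqP/contraT => v0; case: N0; by exists v.
Qed.

(** A nonzero [W] contains [Omega'], so irreducibility of [W] applies to [Omega'] itself, which is
    not zero. *)
Lemma irreducible_eq_Omega' (W : submodule Omega) :
  irreducible W -> W =i Omega'.
Proof.
case=> [[v Wv v0]] /(_ _ (Omega'_subset Wv v0)) [all0|E u]; last by rewrite E.
by have [u /all0 ->] := Omega'_neq0; rewrite eqxx.
Qed.

Definition quot_eval (q : quot_module Omega') : K^o :=
  (repr q : P).@[fun=> kappa].

(** Independence of the representative: two representatives differ by an element of [Omega'], which
    vanishes at $(\kappa,\kappa)$. *)
Lemma quot_eval_pi (v : Omega) :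
  quot_eval (quot_pi Omega' v) = (v : P).@[fun=> kappa].
Proof.
apply/eqP; rewrite -subr_eq0 -mevalB; apply/eqP/Omega'P/quot_piP.
exact: quot_reprK.
Qed.

Fact quot_eval_linear : linear quot_eval.
Proof.
move=> a p q; rewrite -[p]quot_reprK -[q]quot_reprK.
rewrite -[a *: _]quot_piZ -quot_piD !quot_eval_pi.
by rewrite mevalD mevalZ.
Qed.

HB.instance Definition _ :=
  GRing.isLinear.Build K (quot_module Omega') K^o _ quot_eval quot_eval_linear.

Lemma quot_eval_bij : bijective quot_eval.
Proof.
(* The inverse sends a scalar to the class of the constant polynomial. *)
exists (fun c => quot_pi Omega' (c%:MP : P)) => [q|c]; last first.
  by rewrite quot_eval_pi mevalC.
rewrite -[q]quot_reprK quot_eval_pi; apply/quot_piP/Omega'P.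
by rewrite mevalB mevalC subrr.
Qed.

End OmegaSubmodules.

Theorem theorem3p7 (R : realType) (lam1 lam2 kappa : R[i])
    (nz1 : lam1 != 0) (nz2 : lam2 != 0) :
  [/\ irreducible (Omega' kappa nz1 nz2),
      forall W : submodule (Omega kappa nz1 nz2),
        irreducible W -> W =i Omega' kappa nz1 nz2
    & exists phi : {linear quot_module (Omega' kappa nz1 nz2) -> R[i]^o},
        bijective phi].
Proof.
split; first exact: Omega'_irreducible.
  exact: irreducible_eq_Omega'.
by exists (@quot_eval _ _ _ kappa nz1 nz2); exact: quot_eval_bij.
Qed.
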